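(* For every integer $l\ge 1$ there exists an integer $N=N(l)$ such that for every integer $n\ge N$, every irreducible unitary representation $\phi\colon B_n\to U(m)$ of the braid group $B_n$ of degree $m\le ln$ is of level $k$ for some unique integer $k$ with $0\le k\le l$.
   Context: $B_n$ is the braid group on $n$ strands, with generators $x_1,\dots,x_{n-1}$ and relations $x_ix_jx_i=x_jx_ix_j$ if $|i-j|=1$ and $x_ix_j=x_jx_i$ if $|i-j|\ne 1$. $U(m)$ is the unitary group of degree $m$ over $\mathbb{C}$. An irreducible representation $\phi\colon B_n\to U(m)$ is said to be of level $k$ if one of the following is true: (1) $k=0$ and $m=1$; (2) $k\ge 1$ and $kn-(k^2+3k-2)\le m\le kn$. *)

(* Defs.v *)
From HB Require Import structures.
From mathcomp Require Import all_boot all_order all_algebra.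
From mathcomp Require Import generic_quotient complex.
From mathcomp Require Import boolp reals.

Set Implicit Arguments.
Unset Strict Implicit.
Unset Printing Implicit Defensive.

Import Order.TTheory GRing.Theory Num.Theory.
Local Open Scope ring_scope.
Local Open Scope quotient_scope.

(* The group < T | u = v for all u, v with rel u v >. A word is a sequence of
   letters; (x, false) stands for x and (x, true) for the inverse of x. *)
Section Presentation.
Variables (T : choiceType) (rel : seq (T * bool) -> seq (T * bool) -> Prop).

Definition word := seq (T * bool).

Definition inv_letter (a : T * bool) : T * bool := (a.1, ~~ a.2).

Definition inv_word (w : word) : word := rev (map inv_letter w).

Inductive word_eq : word -> word -> Prop :=
| WordRefl u : word_eq u u
| WordSym u v : word_eq u v -> word_eq v u
| WordTrans u v w : word_eq u v -> word_eq v w -> word_eq u w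
| WordCat u u' v v' : word_eq u u' -> word_eq v v' -> word_eq (u ++ v) (u' ++ v')
| WordCancel a : word_eq [:: a; inv_letter a] [::]
| WordRel u v : rel u v -> word_eq u v.

Definition word_eqb (u v : word) : bool := `[< word_eq u v >].

Lemma word_eqb_refl : reflexive word_eqb.
Proof. by move=> u; apply/asboolP; apply: WordRefl. Qed.

Lemma word_eqb_sym : symmetric word_eqb.
Proof. by move=> u v; apply/asboolP/asboolP; apply: WordSym. Qed.

Lemma word_eqb_trans : transitive word_eqb.
Proof.
by move=> v u w /asboolP uv /asboolP vw; apply/asboolP; apply: WordTrans uv vw.
Qed.

Canonical word_equiv :=
  EquivRel word_eqb word_eqb_refl word_eqb_sym word_eqb_trans.

Definition presented := {eq_quot word_equiv}.

HB.instance Definition _ := Choice.on presented.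

Definition to_presented (w : word) : presented := \pi_({eq_quot word_equiv}) w.

Lemma to_presentedP u v : to_presented u = to_presented v <-> word_eq u v.
Proof.
split=> [/eqmodP/asboolP //|uv]; apply/eqmodP; exact/asboolP.
Qed.

Lemma to_presented_ind (P : presented -> Prop) :
  (forall w, P (to_presented w)) -> forall g, P g.
Proof. by move=> Pw g; rewrite -[g]reprK; apply: Pw. Qed.

Lemma inv_letterK : involutive inv_letter.
Proof. by case=> x b; rewrite /inv_letter /= negbK. Qed.

Lemma inv_wordK : involutive inv_word.
Proof.
move=> w; rewrite /inv_word map_rev revK -map_comp.
by rewrite (eq_map (g := id)) ?map_id // => a; apply: inv_letterK.
Qed.

Lemma inv_word_cons a w : inv_word (a :: w) = inv_word w ++ [:: inv_letter a].
Proof. by rewrite /inv_word /= rev_cons cats1. Qed.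

Lemma inv_word_cat u v : inv_word (u ++ v) = inv_word v ++ inv_word u.
Proof. by rewrite /inv_word map_cat rev_cat. Qed.

Lemma word_catV w : word_eq (w ++ inv_word w) [::].
Proof.
elim: w => [|a w IH]; first exact: WordRefl.
rewrite inv_word_cons -cat1s -catA [w ++ _]catA.
apply: (@WordTrans _ ([:: a] ++ [::] ++ [:: inv_letter a])).
  apply: WordCat; first exact: WordRefl.
  by apply: WordCat; [exact: IH | exact: WordRefl].
exact: WordCancel.
Qed.

Lemma word_catNw w : word_eq (inv_word w ++ w) [::].
Proof. by rewrite -{2}[w]inv_wordK; apply: word_catV. Qed.

Lemma word_eq_inv u v : word_eq u v -> word_eq (inv_word u) (inv_word v).
Proof.
move=> uv.
apply: (@WordTrans _ (inv_word u ++ (v ++ inv_word v))).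
  rewrite -{1}[inv_word u]cats0.
  by apply: WordCat; [exact: WordRefl | apply/WordSym/word_catV].
rewrite catA -{2}[inv_word v]cat0s; apply: WordCat; last exact: WordRefl.
apply: (@WordTrans _ (inv_word u ++ u)); last exact: word_catNw.
by apply: WordCat; [exact: WordRefl | exact: WordSym].
Qed.

Definition presented_mul (g h : presented) : presented :=
  to_presented (repr g ++ repr h).
Definition presented_one : presented := to_presented [::].
Definition presented_inv (g : presented) : presented :=
  to_presented (inv_word (repr g)).

Lemma word_eq_repr w : word_eq (repr (to_presented w)) w.
Proof. by apply/to_presentedP; rewrite /to_presented reprK. Qed.

Lemma presented_mulE u v :
  presented_mul (to_presented u) (to_presented v) = to_presented (u ++ v).
Proof. by apply/to_presentedP; apply: WordCat; apply: word_eq_repr. Qed.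

Lemma presented_invE u :
  presented_inv (to_presented u) = to_presented (inv_word u).
Proof. by apply/to_presentedP/word_eq_inv/word_eq_repr. Qed.

Lemma presented_mulA : associative presented_mul.
Proof.
elim/to_presented_ind=> u; elim/to_presented_ind=> v; elim/to_presented_ind=> w.
by rewrite !presented_mulE catA.
Qed.

Lemma presented_mul1 : left_id presented_one presented_mul.
Proof. by elim/to_presented_ind=> u; rewrite presented_mulE. Qed.

Lemma presented_1mul : right_id presented_one presented_mul.
Proof. by elim/to_presented_ind=> u; rewrite presented_mulE cats0. Qed.

Lemma presented_mulVg : left_inverse presented_one presented_inv presented_mul.
Proof.
elim/to_presented_ind=> u; rewrite presented_invE presented_mulE.
exact/to_presentedP/word_catNw.
Qed.

Lemma presented_mulgV : right_inverse presented_one presented_inv presented_mul.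
Proof.
elim/to_presented_ind=> u; rewrite presented_invE presented_mulE.
exact/to_presentedP/word_catV.
Qed.

HB.instance Definition _ := isGroup.Build presented
  presented_mulA presented_mul1 presented_1mul presented_mulVg presented_mulgV.

Definition presented_gen (x : T) : presented := to_presented [:: (x, false)].

Lemma to_presented_cat u v :
  to_presented (u ++ v) = (to_presented u * to_presented v)%g.
Proof. by rewrite -presented_mulE. Qed.

Lemma to_presented_inv u : to_presented (inv_word u) = ((to_presented u)^-1)%g.
Proof. by rewrite -presented_invE. Qed.

End Presentation.

(* The index i : 'I_n.-1 stands for x_(i+1). *)
Inductive braid_rel (n : nat) : word 'I_n.-1 -> word 'I_n.-1 -> Prop :=
| BraidAdj (i j : 'I_n.-1) : `|i - j|%N = 1%N ->
    braid_rel [:: (i, false); (j, false); (i, false)]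
              [:: (j, false); (i, false); (j, false)]
| BraidFar (i j : 'I_n.-1) : `|i - j|%N <> 1%N ->
    braid_rel [:: (i, false); (j, false)] [:: (j, false); (i, false)].

Definition braid_group (n : nat) := presented (@braid_rel n).

Definition braid_gen n (i : 'I_n.-1) : braid_group n :=
  presented_gen (@braid_rel n) i.

Lemma braid_gen_adj n (i j : 'I_n.-1) : `|i - j|%N = 1%N ->
  (braid_gen i * braid_gen j * braid_gen i =
   braid_gen j * braid_gen i * braid_gen j)%g.
Proof.
move=> ij; rewrite /braid_gen /presented_gen -!to_presented_cat /=.
by apply/to_presentedP/WordRel; apply: BraidAdj.
Qed.

Lemma braid_gen_far n (i j : 'I_n.-1) : `|i - j|%N <> 1%N ->
  (braid_gen i * braid_gen j = braid_gen j * braid_gen i)%g.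
Proof.
move=> ij; rewrite /braid_gen /presented_gen -!to_presented_cat /=.
by apply/to_presentedP/WordRel; apply: BraidFar.
Qed.

Section UnitaryGroup.
Variables (C : numClosedFieldType) (m : nat).

Record unitary_group := UnitaryGroup {
  unitary_val :> 'M[C]_m;
  unitary_valP : unitary_val \is unitarymx }.

HB.instance Definition _ := [isSub for unitary_val].
HB.instance Definition _ := [Choice of unitary_group by <:].

Fact unitary_one_subproof : (1%:M : 'M[C]_m) \is unitarymx.
Proof. by apply/unitarymxP; rewrite mul1mx trmx1 map_mx1. Qed.

Definition unitary_one := UnitaryGroup unitary_one_subproof.

Definition unitary_mul (A B : unitary_group) :=
  UnitaryGroup (mul_unitarymx (unitary_valP A) (unitary_valP B)).

Fact unitary_inv_subproof (A : unitary_group) : invmx A \is unitarymx.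
Proof.
by rewrite invmx_unitary ?trmxC_unitary unitary_valP.
Qed.

Definition unitary_inv (A : unitary_group) :=
  UnitaryGroup (unitary_inv_subproof A).

Lemma unitary_mulA : associative unitary_mul.
Proof. by move=> A B D; apply: val_inj; rewrite /= mulmxA. Qed.
Lemma unitary_mul1 : left_id unitary_one unitary_mul.
Proof. by move=> A; apply: val_inj; rewrite /= mul1mx. Qed.
Lemma unitary_1mul : right_id unitary_one unitary_mul.
Proof. by move=> A; apply: val_inj; rewrite /= mulmx1. Qed.
Lemma unitary_mulVg : left_inverse unitary_one unitary_inv unitary_mul.
Proof.
by move=> A; apply: val_inj; rewrite /= mulVmx ?unitarymx_unit ?unitary_valP.
Qed.
Lemma unitary_mulgV : right_inverse unitary_one unitary_inv unitary_mul.
Proof.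
by move=> A; apply: val_inj; rewrite /= mulmxV ?unitarymx_unit ?unitary_valP.
Qed.

HB.instance Definition _ := isGroup.Build unitary_group
  unitary_mulA unitary_mul1 unitary_1mul unitary_mulVg unitary_mulgV.

End UnitaryGroup.

Section Representations.
Variables (C : numClosedFieldType).

(* Matrices act on column vectors from the left; the zero representation is
   not irreducible. *)
Definition irreducible_rep (G : groupType) (m : nat)
    (phi : {multiplicative G -> unitary_group C m}) : Prop :=
  (0 < m)%N /\
  forall W : {vspace 'cV[C]_m},
    (forall (g : G) (v : 'cV[C]_m),
       v \in W -> (phi g : 'M[C]_m) *m v \in W) ->
    W = 0%VS \/ W = fullv.

(* The bound k n - (k^2 + 3 k - 2) may be negative, so it is taken in int. *)
Definition of_level (n m : nat)
    (phi : {multiplicative braid_group n -> unitary_group C m})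
    (k : nat) : Prop :=
  irreducible_rep phi /\
  ((k = 0%N /\ m = 1%N) \/
   ((1 <= k)%N /\
    k%:Z * n%:Z - (k%:Z ^+ 2 + 3 * k%:Z - 2) <= m%:Z <= k%:Z * n%:Z)).

End Representations.

(* Main.v *)
Require Import Defs.
From mathcomp Require Import all_boot all_order all_algebra.
From mathcomp Require Import complex reals.
From mathcomp Require Import all_fingroup zify.

(* Put p = n./2. The images of x_1, x_3, x_5, ... commute, are diagonalizable,
   and are permuted arbitrarily by conjugation, so the set of their joint
   eigenvalues (f_1, ..., f_p) is stable under 'S_p. If a value set K were hit
   by between 2 and p - 2 of the f_i, there would be at least 'C(p, 2) > l n
   distinct joint eigenvalues; so each joint eigenvalue is constant up to one
   entry. The span of those with majority value x is already cut out by any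
   three of the generators, hence is stable under the whole group, and by
   irreducibility (x_i - x)(x_j - x) = 0 whenever |i - j| >= 2.

   After rescaling so that x = 1, let U_i be the image of x_i - 1 and D the
   product of the generators, which sends U_i to U_(i+1). If v lies in
   U_1 and in U_2 + ... + U_(n-2), then D v = x_1 x_2 v lies in U_2 and in
   U_3 + ... + U_(n-1), which x_1 fixes; so x_1 x_2 v = x_2 v is in U_2, hence
   v is in U_2. With r = dim U_1, d = dim (U_1 :&: U_2) and k = r - d this gives
   dim (U_1 + ... + U_j) = j k + d for j <= n - 2. Moreover U_1 :&: U_2 and
   U_2 :&: U_3 are independent in U_2, so d <= k, and therefore
   (n - 2) k + d <= m <= (n - 1) k + d <= n k. *)

Set Implicit Arguments.
Unset Strict Implicit.
Unset Printing Implicit Defensive.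
Import Order.TTheory GRing.Theory Num.Theory.
Local Open Scope ring_scope.

(* X 0, ..., X q.-1 satisfy the relations of the braid group on q + 1 strands;
   X i for q <= i is unconstrained. *)
Definition braid_family (F : fieldType) m q (X : nat -> 'M[F]_m) :=
  [/\ forall i, (i < q)%N -> X i \in unitmx,
      forall i, (i.+1 < q)%N ->
        X i *m X i.+1 *m X i = X i.+1 *m X i *m X i.+1
    & forall i j, (i.+1 < j)%N -> (j < q)%N -> X i *m X j = X j *m X i].

(** Pascal's rule and [p <= 'C(p, 2)] drive the induction; the largest [a] follows from the symmetry
    of binomials. *)
Lemma leq_bin2 p a : (2 <= a)%N -> (a + 2 <= p)%N -> ('C(p, 2) <= 'C(p, a))%N.
Proof.
elim: p a => [|p IH] a a2 ap; first by lia.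
have [->//|a2'] := eqVneq a 2.
have [pa|ap'] := eqVneq (a + 2)%N p.+1.
  by rewrite -pa -(bin_sub (leq_addl a 2)) addnK.
case: a a2 ap a2' ap' => // a a2 ap a2' ap'.
rewrite !binS bin1; have := IH a.+1; have := IH a.
have : (p <= 'C(p, 2))%N by rewrite bin2; nia.
by lia.
Qed.

(** * Joint spectrum of the generators of even index *)

Section JointSpectrum.
Variables (F : fieldType) (m q p : nat) (X : nat -> 'M[F]_m).
Hypothesis Xfam : braid_family q X.
Hypothesis p_le : (p.*2 <= q.+1)%N.

Definition joint_eigenvalue (f : 'I_p -> F) :=
  exists2 v : 'rV[F]_m, v != 0 & forall i : 'I_p, v *m X i.*2 = f i *: v.

Lemma joint_eigenvalue_ext f g :
  f =1 g -> joint_eigenvalue f -> joint_eigenvalue g.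
Proof. by move=> fg [v v0 vf]; exists v => // i; rewrite -fg. Qed.

Lemma far_comm i j : (i.+1 < j)%N || (j.+1 < i)%N || (i == j) ->
  (i < q)%N -> (j < q)%N -> X i *m X j = X j *m X i.
Proof.
case: Xfam => _ _ Xfar /orP[/orP[ij|ji]|/eqP->//] iq jq; first exact: Xfar.
by rewrite -Xfar.
Qed.

Lemma joint_eigenvalue_adj f (i j : 'I_p) : j = i.+1 :> nat ->
  joint_eigenvalue f -> joint_eigenvalue (f \o tperm i j).
Proof.
move=> ji [v v0 vf]; have [Xu Xbr Xfar] := Xfam.
have jp := ltn_ord j.
set a := i.*2; set b := a.+1; set c := b.+1.
have cE : j.*2 = c by rewrite ji.
have cq : (c < q)%N by rewrite -cE; lia.
(* Conjugation by [g] exchanges [X a] and [X c], and fixes the other [X _.*2]. *)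
set g := X b *m X a *m X c *m X b.
have gu : g \in unitmx by rewrite !unitmx_mul !Xu //; lia.
have bra : X a *m X b *m X a = X b *m X a *m X b by apply: Xbr; lia.
have brb : X b *m X c *m X b = X c *m X b *m X c by apply: Xbr; lia.
have ac : X a *m X c = X c *m X a by apply: Xfar; lia.
have ga : X a *m g = g *m X c.
  by rewrite /g !mulmxA bra -!mulmxA; congr (_ *m (_ *m _)); rewrite !mulmxA brb.
have gc : X c *m g = g *m X a.
  rewrite /g -(mulmxA (X b)) ac !mulmxA -brb -!mulmxA.
  by congr (_ *m (_ *m _)); rewrite !mulmxA bra.
exists (v *m g).
  apply: contra v0 => /eqP vg; apply/eqP.
  by rewrite -(mulmxK gu v) vg mul0mx.
move=> l; rewrite -mulmxA /=.
case: tpermP => [->|->|/eqP li /eqP lj].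
- by rewrite -/a -gc mulmxA -cE vf scalemxAl.
- by rewrite cE -ga mulmxA vf scalemxAl.
have lp := ltn_ord l.
have li' : l != i :> nat by [].
have lj' : l != j :> nat by [].
have comm x : x \in [:: a; b; c] -> X x *m X l.*2 = X l.*2 *m X x.
  by rewrite !inE => /or3P[]/eqP->; apply: far_comm; lia.
suff -> : g *m X l.*2 = X l.*2 *m g by rewrite mulmxA vf scalemxAl.
rewrite /g -!mulmxA (comm b) ?inE ?eqxx ?orbT //.
rewrite (mulmxA (X c)) (comm c) ?inE ?eqxx ?orbT //.
rewrite -mulmxA (mulmxA (X a)) (comm a) ?inE ?eqxx // !mulmxA.
by rewrite (comm b) // ?inE ?eqxx ?orbT.
Qed.

(** By induction on the distance [d], every transposition is reached by conjugating with adjacent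
    ones. *)
Lemma joint_eigenvalue_tperm f (i j : 'I_p) :
  joint_eigenvalue f -> joint_eigenvalue (f \o tperm i j).
Proof.
pose Q (s : {perm 'I_p}) :=
    forall f, joint_eigenvalue f -> joint_eigenvalue (fun x => f (s x)).
suff QT d (a b : 'I_p) : b = (a + d)%N :> nat -> Q (tperm a b).
  have [ij|ji] := leqP i j; first by apply: (QT (j - i)%N); rewrite subnKC.
  by rewrite tpermC; apply: (QT (i - j)%N); rewrite subnKC // ltnW.
elim: d b => [|d IH] b ab.
  have -> : b = a by apply/val_inj; rewrite /= ab addn0.
  rewrite tperm1 => h; apply: joint_eigenvalue_ext => x.
  by rewrite perm1.
case: d IH ab => [|d] IH ab.
  by move=> h; apply: joint_eigenvalue_adj; rewrite ab addn1.
have bp : (a + d.+1 < p)%N by have := ltn_ord b; lia.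
pose b' := Ordinal bp.
have Qb : Q (tperm b' b).
  by move=> h; apply: joint_eigenvalue_adj; rewrite ab /= addnS.
have QM s t : Q s -> Q t -> Q (s * t)%g.
  move=> Qs Qt h /Qt/Qs; apply: joint_eigenvalue_ext => x.
  by rewrite permM.
have -> : tperm a b = (tperm a b' ^ tperm b' b)%g.
  rewrite tpermJ tpermL tpermD //; apply/eqP => /(congr1 val) /=; lia.
rewrite /conjg tpermV; apply: (QM _ _ Qb (QM _ _ _ Qb)).
exact: IH.
Qed.

(** Swapping an index of [A :\: B] with one of [B :\: A] keeps [#|A|] and shrinks [A :\: B]. *)
Lemma joint_eigenvalue_set f (K : pred F) (B : {set 'I_p}) :
    joint_eigenvalue f -> #|B| = #|[set i | K (f i)]| ->
  exists2 g, joint_eigenvalue g & B = [set i | K (g i)].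
Proof.
have [N] := ubnP #|[set i | K (f i)] :\: B|.
elim: N f => // N IH f; set A := [set i | K (f i)] => AN hf BA.
have [AB0|AB] := posnP #|A :\: B|.
  exists f => //; apply/esym/eqP; rewrite eqEcard BA leqnn andbT.
  by rewrite -setD_eq0 -cards_eq0 AB0.
have : (0 < #|B :\: A|)%N.
  move: (AB) BA; rewrite -(cardsID A B) -[in RHS](cardsID B A) (setIC A B).
  by move=> AB0 /addnI->.
case/card_gt0P: (AB) => a; rewrite inE => /andP[aB aA].
case/card_gt0P => b; rewrite inE => /andP[bA bB].
apply: (IH (f \o tperm a b)).
- apply: leq_trans (_ : #|(A :\: B) :\ a| < N)%N; last first.
    by rewrite (cardsD1 a) inE aB aA in AN.
  rewrite ltnS; apply: subset_leq_card; apply/subsetP => i.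
  rewrite !inE /= => /andP[iB]; case: tpermP => [->|ib|/eqP ia /eqP ib].
  + by move=> Kb; move: bA; rewrite inE Kb.
  + by rewrite ib bB in iB.
  by rewrite ia iB.
- exact: joint_eigenvalue_tperm.
rewrite BA -(card_imset A (@perm_inj _ (tperm a b))); congr #|pred_of_set _|.
apply/setP => i; rewrite -{1}(tpermK a b i) mem_imset; last exact: perm_inj.
by rewrite !inE.
Qed.

Variables (P : 'M[F]_m) (c : nat -> 'rV[F]_m).
Hypothesis Punit : P \in unitmx.
Hypothesis Pdiag : forall i : 'I_p, P *m X i.*2 = diag_mx (c i) *m P.

(** Expanded in the rows of [P], an eigenvector has some nonzero coordinate [k]; its eigenvalues are
    read off there. *)
Lemma joint_eigenvalue_coord f : joint_eigenvalue f ->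
  exists k, forall i : 'I_p, c i 0 k = f i.
Proof.
case=> v v0 vf.
have [u vE] : exists u, v = u *m P by exists (v *m invmx P); rewrite mulmxKV.
have [k uk] : exists k, u 0 k != 0.
  apply/rV0Pn; apply: contra v0 => /eqP u0; by rewrite vE u0 mul0mx.
exists k => i; have := vf i; rewrite vE -mulmxA Pdiag mulmxA scalemxAl.
move/(can_inj (mulmxK Punit))/rowP/(_ k); rewrite mul_mx_diag !mxE mulrC.
exact: (mulIf uk).
Qed.

Lemma row_neq0 k : row k P != 0.
Proof.
apply/eqP; rewrite rowE => /(congr1 (mulmx^~ (invmx P))).
rewrite mulmxK // mul0mx => /rowP/(_ k)/eqP.
by rewrite !mxE !eqxx /= oner_eq0.
Qed.

Lemma row_eigen k (i : 'I_p) : row k P *m X i.*2 = c i 0 k *: row k P.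
Proof. by rewrite -row_mul Pdiag row_mul row_diag_mx -scalemxAl -rowE. Qed.

Lemma joint_eigenvalue_row k : joint_eigenvalue (fun i => c i 0 k).
Proof. by exists (row k P); [apply: row_neq0 | move=> i; apply: row_eigen]. Qed.

(** Each set of this cardinality comes from a joint eigenvalue, hence from one of the [m] rows of
    [P]. *)
Lemma bin_joint_eigenvalue f (K : pred F) : joint_eigenvalue f ->
  ('C(p, #|[set i | K (f i)]|) <= m)%N.
Proof.
move=> hf; rewrite -{1}(card_ord p) -card_draws.
have := leq_imset_card (fun k => [set i : 'I_p | K (c i 0 k)]) 'I_m.
rewrite card_ord; apply: leq_trans.
apply: subset_leq_card; apply/subsetP => B; rewrite inE => /eqP BA.
have [g hg ->] := joint_eigenvalue_set hf BA.
have [k ck] := joint_eigenvalue_coord hg.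
by apply/imsetP; exists k => //; apply/setP => i; rewrite !inE ck.
Qed.

Hypothesis p_ge7 : (7 <= p)%N.
Hypothesis m_lt : (m < 'C(p, 2))%N.

Lemma joint_eigenvalue_almost_const f : joint_eigenvalue f ->
  exists x, (#|[set i | f i != x]| <= 1)%N.
Proof.
move=> hf.
have small (K : pred F) : (#|[set i | K (f i)]| <= 1)%N \/
    (#|[set i | ~~ K (f i)]| <= 1)%N.
  have := bin_joint_eigenvalue K hf.
  have := cardsC [set i | K (f i)]; rewrite card_ord.
  have -> : ~: [set i | K (f i)] = [set i | ~~ K (f i)].
    by apply/setP => i; rewrite !inE.
  have := @leq_bin2 p #|[set i | K (f i)]|; lia.
have p0 : (0 < p)%N by lia.
have p1 : (1 < p)%N by lia.
(* If neither [f i0] nor [f i1] is a majority value, each is taken at most once. Together they are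
   then taken exactly twice, which contradicts [small] as [p] is at least 7. *)
pose i0 := Ordinal p0; pose i1 := Ordinal p1.
have [c0|] := small (pred1 (f i0)); last by exists (f i0).
have [c1|] := small (pred1 (f i1)); last by exists (f i1).
have := small (pred2 (f i0) (f i1)).
have := cardsC [set i | pred2 (f i0) (f i1) (f i)]; rewrite card_ord.
have -> : ~: [set i | pred2 (f i0) (f i1) (f i)] =
          [set i | ~~ pred2 (f i0) (f i1) (f i)].
  by apply/setP => i; rewrite !inE.
have : (2 <= #|[set i | pred2 (f i0) (f i1) (f i)]|)%N.
  rewrite -[2%N]/(i0 != i1).+1 -cards2; apply: subset_leq_card.
  by apply/subsetP => i; rewrite !inE => /orP[]/eqP->; rewrite eqxx ?orbT.
have -> : [set i | pred2 (f i0) (f i1) (f i)] =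
          [set i | pred1 (f i0) (f i)] :|: [set i | pred1 (f i1) (f i)].
  by apply/setP => i; rewrite !inE.
rewrite cardsU; lia.
Qed.

Hypothesis irr : forall W : 'M[F]_m,
  (forall i, (i < q)%N -> (W *m X i <= W)%MS) -> W = 0 \/ row_full W.

Lemma coord_kernel (u : 'rV[F]_m) x (a b : 'I_p) :
  u *m P *m (X a.*2 - x%:M) *m (X b.*2 - x%:M) = 0 <->
  forall k, u 0 k * ((c a 0 k - x) * (c b 0 k - x)) = 0.
Proof.
have Pd (i : 'I_p) : P *m (X i.*2 - x%:M) = diag_mx (c i - const_mx x) *m P.
  rewrite mulmxBr Pdiag (raddfB diag_mx) mulmxBl mul_mx_scalar -mul_scalar_mx.
  by congr (_ - _ *m _); apply/matrixP => k l; rewrite !mxE.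
rewrite -(mulmxA u) Pd mulmxA -mulmxA Pd mulmxA.
split=> [/(congr1 (mulmx^~ (invmx P)))|uk].
  rewrite mulmxK // mul0mx => /rowP uk k; have := uk k.
  by rewrite !mul_mx_diag !mxE mulrA.
rewrite [X in X *m P](_ : _ = 0) ?mul0mx //; apply/rowP => k.
by rewrite !mul_mx_diag !mxE -mulrA.
Qed.

(** A value taken twice must be the majority value [y], and of two distinct entries at least one
    equals it. *)
Lemma shared_majority (f : 'I_p -> F) x y (s t a b : 'I_p) :
    (#|[set i | f i != y]| <= 1)%N -> s != t -> f s = x -> f t = x -> a != b ->
  (f a - x) * (f b - x) = 0.
Proof.
move=> fy st fs ft ab.
have pair i j : i != j -> f i != y -> f j != y -> False.
  move=> ij fi fj; have : (2 <= #|[set i | f i != y]|)%N.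
    rewrite -[2%N]/(true.+1) -ij -cards2; apply: subset_leq_card.
    by apply/subsetP => k; rewrite !inE => /orP[]/eqP->.
  by lia.
have xy : x = y.
  apply/eqP/negPn/negP => xy; apply: (pair s t) => //; by rewrite ?fs ?ft.
apply/eqP; rewrite mulf_eq0 !subr_eq0 xy -[_ || _]negbK negb_or.
by apply/negP => /andP[]; apply: pair.
Qed.

Lemma exists_majority_eigenvalue : (0 < m)%N ->
  exists2 x, x != 0 & (X 0 - x%:M) *m (X 2 - x%:M) = 0.
Proof.
move=> m0; pose k0 := Ordinal m0.
have [x x_k0] := joint_eigenvalue_almost_const (joint_eigenvalue_row k0).
(* Only [o 0] to [o 6] are used, so the default value of [insubd] never appears. *)
pose o i : 'I_p := insubd (Ordinal (leq_trans (isT : 0 < 7)%N p_ge7)) i.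
have oE i : (i < 7)%N -> o i = i :> nat.
  by move=> i7; rewrite val_insubd (leq_trans i7).
have o_uniq i : (i.+2 < 7)%N -> uniq [:: o i; o i.+1; o i.+2].
  move=> i7; rewrite /= !inE -!val_eqE /= !oE //; lia.
pose B i := X i.*2 - x%:M.
(* [W] is spanned by the rows of [P] with majority value [x]. *)
pose W := (\bigcap_(ab : 'I_p * 'I_p | ab.1 != ab.2) kermx (B ab.1 *m B ab.2))%MS.
have WP n (u : 'M_(n, m)) :
    reflect (forall a b : 'I_p, a != b -> u *m B a *m B b = 0) (u <= W)%MS.
  apply: (iffP idP) => [/sub_bigcapmxP h a b ab|h].
    by rewrite -mulmxA; apply/sub_kermxP/(h (a, b)).
  by apply/sub_bigcapmxP => -[a b] /= ab; apply/sub_kermxP; rewrite mulmxA h.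
(* Majority is decided by any three entries. *)
have W3 (u : 'rV_m) (i1 i2 i3 : 'I_p) : uniq [:: i1; i2; i3] ->
    u *m B i1 *m B i2 = 0 -> u *m B i1 *m B i3 = 0 -> u *m B i2 *m B i3 = 0 ->
    (u <= W)%MS.
  have [w ->] : exists w, u = w *m P by exists (u *m invmx P); rewrite mulmxKV.
  rewrite /= !inE negb_or andbT => /andP[/andP[n12 n13] n23].
  move=> /coord_kernel e12 /coord_kernel e13 /coord_kernel e23.
  apply/WP => a b ab; apply/coord_kernel => k.
  have [y yk] := joint_eigenvalue_almost_const (joint_eigenvalue_row k).
  have [->|wk] := eqVneq (w 0 k) 0; first by rewrite mul0r.
  have root2 i j : w 0 k * ((c i 0 k - x) * (c j 0 k - x)) = 0 ->
      c i 0 k = x \/ c j 0 k = x.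
    move/eqP; rewrite !mulf_eq0 (negPf wk) !subr_eq0 /=.
    by case/orP => /eqP; [left | right].
  have maj := shared_majority yk _ _ _ ab.
  suff -> : (c a 0 k - x) * (c b 0 k - x) = 0 by rewrite mulr0.
  case: (root2 _ _ (e12 k)) => h1.
    by case: (root2 _ _ (e23 k)) => h2; [apply: (maj _ i1 i2) | apply: (maj _ i1 i3)].
  by case: (root2 _ _ (e13 k)) => h2; [apply: (maj _ i1 i2) | apply: (maj _ i2 i3)].
have comm i j (v : 'M_m) : X i.*2 *m X j = X j *m X i.*2 ->
    v *m X j *m B i = v *m B i *m X j.
  move=> cij; rewrite -!mulmxA /B mulmxBr mulmxBl cij.
  by rewrite mul_scalar_mx mul_mx_scalar.
have Winv j : (j < q)%N -> (W *m X j <= W)%MS.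
  move=> jq.
  (* [X j] commutes with [X 8], [X 10], [X 12] if [j <= 6] and with [X 0], [X 2], [X 4] otherwise;
     this uses [7 <= p]. *)
  have [i1 [i2 [i3 [i_uniq c1 c2 c3]]]] : exists i1 i2 i3 : 'I_p,
     [/\ uniq [:: i1; i2; i3], X i1.*2 *m X j = X j *m X i1.*2,
         X i2.*2 *m X j = X j *m X i2.*2 & X i3.*2 *m X j = X j *m X i3.*2].
    have [j6|j7] := leqP j 6.
      exists (o 4), (o 5), (o 6); rewrite !oE //.
by split; [apply: o_uniq | apply: far_comm; lia..].
    exists (o 0), (o 1), (o 2); rewrite !oE //.
by split; [apply: o_uniq | apply: far_comm; lia..].
  have := elimT (WP _ _) (submx_refl W).
  move: (i_uniq); rewrite /= !inE negb_or andbT => /andP[/andP[n12 n13] n23] Wab.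
  apply/row_subP => i; apply: (W3 _ i1 i2 i3 i_uniq);
    by rewrite -!row_mul !comm // Wab // mul0mx row0.
have [s [t [st cs ct]]] : exists s t : 'I_p,
    [/\ s != t, c s 0 k0 = x & c t 0 k0 = x].
  have : (1 < #|~: [set i : 'I_p | c i 0%R k0 != x]|)%N.
    rewrite -(leq_add2l #|[set i : 'I_p | c i 0%R k0 != x]|) cardsC card_ord.
    by apply: leq_trans (leq_add x_k0 (leqnn 2)) _; apply: leq_trans p_ge7.
  case/card_gt1P => s [t [sx tx st]]; exists s, t.
  by move: sx tx; rewrite !inE !negbK => /eqP-> /eqP->.
(* [W] contains [row k0 P], so it is not zero. *)
have [|Wfull] := irr Winv.
  move=> W0.
  have : (row k0 P <= W)%MS.
    rewrite rowE; apply/WP => a b ab; apply/coord_kernel => k.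
    rewrite !mxE eqxx /=; have [->|] := eqVneq k k0; last by rewrite mul0r.
    rewrite mul1r; exact: (shared_majority x_k0 st).
  by rewrite W0 submx0 (negPf (row_neq0 k0)).
exists x.
  apply/eqP => x0; have /eqP := row_eigen k0 s; rewrite cs x0 scale0r.
  have Xu : X s.*2 \in unitmx.
    by case: Xfam => Xu _ _; apply: Xu; have := ltn_ord s; lia.
  by rewrite mulmx_free_eq0 ?row_free_unit // (negPf (row_neq0 k0)).
have := WP _ 1%:M; rewrite submx_full // => WP1.
have := elimT WP1 isT (o 0) (o 1).
by rewrite mul1mx /B !oE //; apply; rewrite -val_eqE /= !oE.
Qed.

End JointSpectrum.

(** * Dimension count *)

Section AlmostOrthogonal.
Variables (F : fieldType) (m q : nat) (Y : nat -> 'M[F]_m).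
Hypothesis Yfam : braid_family q Y.

(* The factors are in decreasing order because the action is on row vectors. *)
Fixpoint garland j : 'M[F]_m := if j is i.+1 then Y i *m garland i else 1%:M.

Lemma garland_unit j : (j <= q)%N -> garland j \in unitmx.
Proof.
case: Yfam => Yu _ _; elim: j => [|j IH] jq /=; first exact: unitmx1.
by rewrite unitmx_mul Yu // IH // ltnW.
Qed.

Lemma garland_comm i j : (j < i)%N -> (i < q)%N ->
  Y i *m garland j = garland j *m Y i.
Proof.
case: Yfam => _ _ Yfar; elim: j => [|j IH] ji iq /=.
  by rewrite mulmx1 mul1mx.
by rewrite mulmxA -(Yfar j i) // -mulmxA IH ?mulmxA // ltnW.
Qed.

(** [Y i] passes the factors above [i.+1], becomes [Y i.+1] by the braid relation, and then passes
    [garland i]. *)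
Lemma garland_shift i j : (i.+1 < j)%N -> (j <= q)%N ->
  Y i *m garland j = garland j *m Y i.+1.
Proof.
case: (Yfam) => _ Ybr Yfar; elim: j => // j IH ij jq.
have [ij'|ji] := ltnP i.+1 j.
  by rewrite /= mulmxA Yfar // -mulmxA IH ?mulmxA // ltnW.
have -> : j = i.+1 by lia.
rewrite /= !mulmxA Ybr ?(leq_trans _ jq) //.
by rewrite -!mulmxA garland_comm //; lia.
Qed.

(** The row space of [A i] is U_(i+1) in the opening outline, [garland q] is D there, and [q] is n -
    1. *)
Let A i := Y i - 1%:M.
Hypothesis far0 : forall i j, (i.+1 < j)%N -> (j < q)%N -> A i *m A j = 0.
Hypothesis semisimple : (A 0 :&: kermx (A 0))%MS = 0.
Hypothesis q_ge3 : (3 <= q)%N.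

Lemma far0C i j : (i.+1 < j)%N -> (j < q)%N -> A j *m A i = 0.
Proof.
move=> ij jq; case: (Yfam) => _ _ Yfar; rewrite -[RHS](far0 ij jq) /A.
rewrite !(mulmxBl, mulmxBr) !(mulmx1, mul1mx) (Yfar i j) //.
by rewrite !opprB !addrA addrAC [RHS]addrAC; congr (_ + _); rewrite addrAC.
Qed.

Lemma rowspace_shift i : (i.+1 < q)%N -> (A i *m garland q :=: A i.+1)%MS.
Proof.
move=> iq; rewrite mulmxBl garland_shift // mul1mx -{2}[garland q]mulmx1 -mulmxBr.
by apply: eqmxMfull; rewrite row_full_unit garland_unit.
Qed.

Lemma rank_garland p (W : 'M_(p, m)) : \rank (W *m garland q) = \rank W.
Proof. by apply: mxrankMfree; rewrite row_free_unit garland_unit. Qed.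

Let S j := (\sum_(i < j) A i)%MS.
Let S' j := (\sum_(i < j) A i.+1)%MS.

Lemma sum_shift j : (j < q)%N -> (S j *m garland q :=: S' j)%MS.
Proof.
move=> jq; apply: eqmx_trans (sumsmxMr _ _ _) _.
by apply: eqmx_sums => i _; apply: rowspace_shift; have := ltn_ord i; lia.
Qed.

Lemma fix_far p (W : 'M_(p, m)) i :
  (W <= A 0)%MS -> (1 < i)%N -> (i < q)%N -> W *m Y i = W.
Proof.
move=> /submxP[D ->] i1 iq.
have /eqP : D *m A 0 *m A i = 0 by rewrite -mulmxA far0 ?mulmx0.
by rewrite /(A i) mulmxBr mulmx1 subr_eq0 => /eqP.
Qed.

(** The factors [Y i] with [1 < i] act first, and they fix [W]. *)
Lemma garland_fix p (W : 'M_(p, m)) j : (W <= A 0)%MS -> (j.+2 <= q)%N ->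
  W *m garland j.+2 = W *m Y 1 *m Y 0.
Proof.
move=> WA; elim: j => [|j IH] jq; first by rewrite /= mulmx1 mulmxA.
by rewrite -[garland _]/(Y j.+2 *m garland j.+2) mulmxA fix_far // IH // ltnW.
Qed.

Lemma cap_sum j : (0 < j)%N -> (j.+1 < q)%N ->
  (A 0 :&: S' j :=: A 0 :&: A 1)%MS.
Proof.
move=> j0 jq; apply/eqmxP; rewrite !sub_capmx !capmxSl /= andbC.
apply/andP; split.
  apply: submx_trans (capmxSr _ _) _.
  exact: (sumsmx_sup (Ordinal j0)).
set W := (A 0 :&: S' j)%MS.
have WA : (W <= A 0)%MS := capmxSl _ _.
have WS : (W <= S' j)%MS := capmxSr _ _.
have Wg : W *m garland q = W *m Y 1 *m Y 0.
  by have := @garland_fix _ W q.-2 WA; rewrite -subn2 -addn2 subnK ?(ltnW q_ge3) //; apply.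
have W1 : (W *m Y 1 *m Y 0 <= A 1)%MS.
  rewrite -Wg -(rowspace_shift (i := 0)) ?(ltnW q_ge3) //; exact: submxMr.
(* [garland q] carries [S' j] to the sum of [A 2], ..., [A j.+1], which [A 0] kills; so [Y 0] fixes
   [W *m Y 1 *m Y 0]. *)
have W0 : W *m Y 1 *m Y 0 *m A 0 = 0.
  apply/sub_kermxP; rewrite -Wg; apply: submx_trans (submxMr _ WS) _.
  rewrite sumsmxMr; apply/sumsmx_subP => i _.
  have ij := ltn_ord i.
  rewrite rowspace_shift; last by lia.
  by apply/sub_kermxP; rewrite far0C //; lia.
have Y0u : Y 0 \in unitmx by case: Yfam => Yu _ _; apply: Yu; lia.
have W2 : W *m Y 1 *m Y 0 = W *m Y 1.
  move/eqP: W0; rewrite mulmxBr mulmx1 subr_eq0 => /eqP.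
  by move/(can_inj (mulmxK Y0u)).
have -> : W = W *m Y 1 - W *m A 1.
  by rewrite mulmxBr mulmx1 opprB addrC subrK.
rewrite addmx_sub //; first by rewrite -W2.
by rewrite eqmx_opp submxMl.
Qed.

Let r := \rank (A 0).
Let d := \rank (A 0 :&: A 1)%MS.

(** [S j.+1] is [A 0 + S' j], and [S' j] has the rank of [S j] because [garland q] is invertible. *)
Lemma rank_sum_recl j : (j < q)%N ->
  (\rank (S j.+1) + \rank (A 0 :&: S' j)%MS = r + \rank (S j))%N.
Proof.
move=> jq; rewrite /(S j.+1) big_ord_recl mxrank_sum_cap.
by rewrite -(rank_garland (S j)) sum_shift.
Qed.

Lemma rank_sum j : (j.+1 < q)%N -> (\rank (S j.+1) + j * d = j.+1 * r)%N.
Proof.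
elim: j => [|j IH] jq; first by rewrite /S big_ord1 mul0n addn0 mul1n.
have := rank_sum_recl (ltnW jq); rewrite (cap_sum _ jq) // -/d.
by have := IH (ltnW jq); nia.
Qed.

(** [A 0 :&: A 1] and its shift into [A 1 :&: A 2] are independent in [A 1]: a common vector lies in
    [A 0] and, being in [A 2], is killed by [A 0]. *)
Lemma cap_le_half : (2 * d <= r)%N.
Proof.
have r1 : \rank (A 1) = r by rewrite /r -(rank_garland (A 0)) rowspace_shift //; lia.
have d1 : (d <= \rank (A 1 :&: A 2)%MS)%N.
  rewrite -[d]rank_garland; apply: mxrankS; apply: submx_trans (capmxMr _ _ _) _.
  by rewrite capmxS // rowspace_shift //; lia.
have le1 : (A 0 :&: A 1 + A 1 :&: A 2 <= A 1)%MS.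
  by rewrite addsmx_sub capmxSl capmxSr.
have cap0 : ((A 0 :&: A 1) :&: (A 1 :&: A 2) = 0)%MS.
  apply/eqP; rewrite -submx0 -semisimple sub_capmx.
  rewrite (submx_trans (capmxSl _ _) (capmxSl _ _)) /=.
  apply: submx_trans (capmxSr _ _) _; apply: submx_trans (capmxSr _ _) _.
  by apply/sub_kermxP; rewrite far0C.
have := mxrank_sum_cap (A 0 :&: A 1)%MS (A 1 :&: A 2)%MS.
rewrite cap0 mxrank0 addn0 -/d => sum_rank.
by have := mxrankS le1; rewrite r1 sum_rank; lia.
Qed.

Hypothesis full : row_full (S q).

Lemma dim_bounds : exists k d,
  [/\ (d <= k)%N, (q.-1 * k + d <= m)%N & (m <= q * k + d)%N].
Proof.
exists (r - d)%N, d; have dr := cap_le_half.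
have q2 : q = q.-2.+2 by lia.
have rk := @rank_sum q.-2; have rkq := @rank_sum_recl q.-1.
have /eqP Sm := full.
(* [cap_sum] does not reach the last sum. Only this lower bound is available there, which leaves an
   interval for [m]. *)
have capd : (d <= \rank (A 0 :&: S' q.-1)%MS)%N.
  apply: mxrankS; apply: capmxS => //.
  have q1 : (0 < q.-1)%N by lia.
  exact: (sumsmx_sup (Ordinal q1)).
have := rank_leq_row (S q.-1); move: rk rkq Sm capd.
have -> : q.-1 = q.-2.+1 by lia.
rewrite -q2 => rk rkq Sm capd Sle.
have {}rk := rk ltac:(lia); have {}rkq := rkq ltac:(lia).
have [k rE dk] : exists2 k, r = (k + d)%N & (d <= k)%N.
  by exists (r - d)%N; lia.
rewrite rE addnK; rewrite rE in rk rkq.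
have {}rk : \rank (S q.-2.+1) = (q.-2.+1 * k + d)%N.
  by move: rk => /=; rewrite -[X in \rank X]/(S q.-2.+1); nia.
have qk : (q * k = q.-2.+1 * k + k)%N by rewrite {1}q2 mulSn addnC.
by split=> //; lia.
Qed.
End AlmostOrthogonal.
(** In an eigenbasis [A - x%:M] is diagonal, and a scalar killed by the square of a diagonal entry
    is killed by the entry. *)
Lemma diagonalizable_capmx_ker (F : fieldType) m (A : 'M[F]_m) x :
  diagonalizable A -> ((A - x%:M) :&: kermx (A - x%:M) = 0)%MS.
Proof.
case=> P Pu /diagonalizable_forPex[d0 /(simmxP Pu) PA].
set B := A - x%:M; have [d PB] : exists d, P *m B = diag_mx d *m P.
  exists (d0 - const_mx x).
  rewrite mulmxBr PA (raddfB diag_mx) mulmxBl mul_mx_scalar -mul_scalar_mx.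
  by congr (_ - _ *m _); apply/matrixP => k l; rewrite !mxE.
set W := (_ :&: _)%MS.
have WB0 : W *m B = 0 by apply/sub_kermxP/capmxSr.
have [D WD] : exists D, W = D *m diag_mx d *m P.
  have /submxP[E ->] : (W <= B)%MS by apply: capmxSl.
  by exists (E *m invmx P); rewrite -mulmxA -PB mulmxA mulmxKV.
rewrite WD [X in X *m P](_ : _ = 0) ?mul0mx //.
move: WB0; rewrite WD -[_ *m P *m B]mulmxA PB mulmxA => /(congr1 (mulmx^~ (invmx P))).
rewrite mulmxK // mul0mx => /matrixP DD; apply/matrixP => i j.
have := DD i j; rewrite !mul_mx_diag !mxE => /eqP.
by rewrite !mulf_eq0 -orbA orbb -mulf_eq0 => /eqP.
Qed.

(** * Dimensions of irreducible braid families *)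

Section Irreducible.
Variables (F : fieldType) (m q : nat) (X : nat -> 'M[F]_m).
Hypothesis Xfam : braid_family q X.

(** Conjugation by [X i.+1 *m X i] turns [X i] into [X i.+1]: starting from (0, 2), first the right
    index is raised, then the left. *)
Lemma far_product0 x : (X 0 - x%:M) *m (X 2 - x%:M) = 0 ->
  forall i j, (i.+1 < j)%N -> (j < q)%N -> (X i - x%:M) *m (X j - x%:M) = 0.
Proof.
have [Xu Xbr Xfar] := Xfam.
pose B i := X i - x%:M; rewrite -/(B 0) -/(B 2) => B02.
have move2 g i j k l : g \in unitmx -> X i *m g = g *m X k ->
    X j *m g = g *m X l -> B i *m B j = 0 -> B k *m B l = 0.
  have moveB a b : X a *m g = g *m X b -> B a *m g = g *m B b.
    by rewrite /B mulmxBl mulmxBr => ->; rewrite mul_scalar_mx mul_mx_scalar.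
  move=> gu /moveB ik /moveB jl Bij.
  rewrite -[LHS](mulKmx gu) (_ : g *m _ = 0) ?mulmx0 //.
  by rewrite mulmxA -ik -mulmxA -jl mulmxA Bij mul0mx.
have slide i : (i.+1 < q)%N -> X i *m (X i.+1 *m X i) = X i.+1 *m X i *m X i.+1.
  by move=> iq; rewrite mulmxA Xbr.
have pair_unit i : (i.+1 < q)%N -> X i.+1 *m X i \in unitmx.
  by move=> iq; rewrite unitmx_mul !Xu // ltnW.
have B0 j : (j.+2 < q)%N -> B 0 *m B j.+2 = 0.
  elim: j => // j IH jq; have := IH (ltnW jq).
  apply: (move2 (X j.+3 *m X j.+2)); [exact: pair_unit | | exact: slide].
  by rewrite mulmxA Xfar // -mulmxA Xfar ?mulmxA // ltnW.
elim=> [|i IH] j ij jq; first by case: j ij jq => [|[|j]] // _; apply: B0.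
have iq : (i.+1 < q)%N by lia.
have := IH j (ltnW ij) jq.
apply: (move2 (X i.+1 *m X i)); [exact: pair_unit | exact: slide |].
by rewrite mulmxA -Xfar // -mulmxA -Xfar ?mulmxA // ltnW.
Qed.

Hypothesis Xdiag : forall i, (i < q)%N -> diagonalizable (X i).
Hypothesis irr : forall W : 'M[F]_m,
  (forall i, (i < q)%N -> (W *m X i <= W)%MS) -> W = 0 \/ row_full W.

(** Scalars preserve every subspace, in particular the line spanned by [pid_mx 1]. *)
Lemma scalar_family_dim x : (0 < m)%N ->
  (forall i, (i < q)%N -> X i = x%:M) -> m = 1%N.
Proof.
move=> m0 Xx; have W i : (i < q)%N ->
    ((pid_mx 1 : 'M_m) *m X i <= (pid_mx 1 : 'M_m))%MS.
  by move=> iq; rewrite Xx // mul_mx_scalar scalemx_sub.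
have r1 : \rank (pid_mx 1 : 'M[F]_m) = 1%N by rewrite rank_pid_mx.
case: (irr W) => [W0|]; first by move: r1; rewrite W0 mxrank0.
by rewrite /row_full r1 => /eqP.
Qed.

Lemma irreducible_family_dim p : (p.*2 <= q.+1)%N -> (7 <= p)%N ->
    (0 < m < 'C(p, 2))%N ->
  m = 1%N \/ exists k d,
    [/\ (0 < k)%N, (d <= k)%N, (q.-1 * k + d <= m)%N & (m <= q * k + d)%N].
Proof.
move=> pq p7 /andP[m0 mp]; have [Xu Xbr Xfar] := Xfam.
have iq (i : 'I_p) : (i.*2 < q)%N by have := ltn_ord i; lia.
have : codiagonalizable [seq X i.*2 | i : 'I_p].
  apply/codiagonalizableP; split=> [A B /imageP[i _ ->] /imageP[j _ ->]|A /imageP[i _ ->]].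
    by apply: (far_comm Xfam) => //; lia.
  exact: Xdiag.
case=> P Pu /allP Pd.
have /fin_all_exists[c0 c0P] (i : 'I_p) : exists d, P *m X i.*2 = diag_mx d *m P.
  have /Pd/diagonalizable_forPex[d /(simmxP Pu)] : X i.*2 \in [seq X i.*2 | i : 'I_p].
    by apply/imageP; exists i.
  by exists d.
(* The value 0 outside ['I_p] is a mere filler. *)
pose c i := if insub i is Some j then c0 j else 0.
have cP (i : 'I_p) : P *m X i.*2 = diag_mx (c i) *m P by rewrite /c valK.
have [x x0 B02] := exists_majority_eigenvalue Xfam pq Pu cP p7 mp irr m0.
pose Y i := x^-1 *: X i.
have YB i : Y i - 1%:M = x^-1 *: (X i - x%:M).
  by rewrite scalerBr scale_scalar_mx mulVf.
have xu : x^-1 \is a GRing.unit by rewrite unitfE invr_eq0.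
have Yfam : braid_family q Y.
  split=> [i iq'|i iq'|i j ij jq]; rewrite /Y ?unitmxZ ?Xu //.
    by rewrite -!scalemxAl -!scalemxAr -!scalemxAl Xbr.
  by rewrite -!scalemxAl -!scalemxAr Xfar.
have Bfar := far_product0 B02.
have Yfar i j : (i.+1 < j)%N -> (j < q)%N -> (Y i - 1%:M) *m (Y j - 1%:M) = 0.
  by move=> ij jq; rewrite !YB -scalemxAl -scalemxAr Bfar // !scaler0.
have semi : ((Y 0 - 1%:M) :&: kermx (Y 0 - 1%:M) = 0)%MS.
  apply: diagonalizable_capmx_ker.
  have /Xdiag[Q Qu /diagonalizable_forPex[d /(simmxP Qu) QX]] : (0 < q)%N by lia.
  exists Q => //; apply/diagonalizable_forPex; exists (x^-1 *: d).
  by apply/(simmxP Qu); rewrite -scalemxAr QX scalemxAl linearZ.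
pose S := (\sum_(i < q) (Y i - 1%:M))%MS.
(* Up to the factor [x], [X i] changes a row [w] by [w *m (Y i - 1%:M)], which lies in [S]. *)
have Sstable i : (i < q)%N -> (S *m X i <= S)%MS.
  move=> iq'; have -> : X i = x *: ((Y i - 1%:M) + 1%:M).
    by rewrite subrK scalerA divff // scale1r.
  rewrite -scalemxAr scalemx_sub // mulmxDr mulmx1 addmx_sub //.
  apply: submx_trans (submxMl _ _) _; exact: (sumsmx_sup (Ordinal iq')).
have q3 : (3 <= q)%N by lia.
case: (irr Sstable) => [S0|Sfull].
  left; apply: (scalar_family_dim (x := x)) => // i iq'.
  have : (Y i - 1%:M <= S)%MS by apply: (sumsmx_sup (Ordinal iq')).
  rewrite S0 submx0 YB scaler_eq0 invr_eq0 (negPf x0) subr_eq0 /=.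
  by move/eqP.
right; have [k [d [dk lo hi]]] := dim_bounds Yfam Yfar semi q3 Sfull.
(* [k = 0] would force [d = 0] and then [m = 0]. *)
by exists k, d; split=> //; case: (k) dk hi => //; lia.
Qed.

End Irreducible.
Lemma diagonalizable_unitarymx (C : numClosedFieldType) m (A : 'M[C]_m) :
  A \is unitarymx -> diagonalizable A.
Proof.
move=> Au; have /orthomx_spectralP AE : A \is normalmx.
  by apply/normalmxP; rewrite -invmx_unitary // mulmxV ?mulVmx ?unitarymx_unit.
exists (spectralmx A); first exact: spectral_unit.
apply/diagonalizable_forPex; exists (spectral_diag A).
apply/(simmxP (spectral_unit A)).
by rewrite {2}AE !mulmxA mulmxV ?mul1mx ?spectral_unit.
Qed.

(** * The matrices of a representation *)

Section Representation.
Variables (C : numClosedFieldType) (q m : nat).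
Variable phi : {multiplicative braid_group q.+2 -> unitary_group C m}.

(* Transposed, because mathcomp's subspaces of 'M_m are spanned by rows while
   the representation acts on columns. *)
Definition gen_mx (i : nat) : 'M[C]_m :=
  (phi (braid_gen (n := q.+2) (inord i)) : 'M[C]_m)^T.

Lemma rep_mxM g h : (phi (g * h)%g : 'M[C]_m) = (phi g : 'M[C]_m) *m phi h.
Proof. by rewrite gmulfM. Qed.

Lemma rep_mx_unit g : (phi g : 'M[C]_m) \in unitmx.
Proof. exact/unitarymx_unit/unitary_valP. Qed.

Lemma rep_mx1 : (phi 1%g : 'M[C]_m) = 1%:M.
Proof.
by rewrite -[LHS](mulKmx (rep_mx_unit 1%g)) -rep_mxM mulg1 mulVmx ?rep_mx_unit.
Qed.

Lemma rep_mxV g : (phi (g^-1)%g : 'M[C]_m) = invmx (phi g).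
Proof.
by rewrite -[LHS](mulKmx (rep_mx_unit g)) -rep_mxM mulgV rep_mx1 mulmx1.
Qed.

Lemma gen_mx_unitary i : gen_mx i \is unitarymx.
Proof. by rewrite trmx_unitary unitary_valP. Qed.

Lemma gen_mx_braid_family : braid_family q.+1 gen_mx.
Proof.
split=> [i _|i iq|i j ij jq]; first exact/unitarymx_unit/gen_mx_unitary.
  rewrite /gen_mx -!trmx_mul -!rep_mxM !mulgA braid_gen_adj //=.
  by rewrite !inordK ?(ltnW iq) // distnS.
rewrite /gen_mx -!trmx_mul -!rep_mxM braid_gen_far //=.
by rewrite !inordK; lia.
Qed.

Lemma stable_rep (W : 'M[C]_m) :
    (forall i, (i < q.+1)%N -> (W *m gen_mx i <= W)%MS) ->
  forall g, (W *m (phi g : 'M[C]_m)^T <= W)%MS.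
Proof.
move=> Wgen; elim/to_presented_ind; elim=> [|[i b] w IH].
  have -> : to_presented (@braid_rel q.+2) [::] = 1%g by [].
  by rewrite rep_mx1 trmx1 mulmx1.
rewrite -cat1s to_presented_cat rep_mxM trmx_mul mulmxA.
apply: submx_trans (submxMr _ IH) _.
have Wi : (W *m (phi (braid_gen i) : 'M[C]_m)^T <= W)%MS.
  by have := Wgen i (ltn_ord i); rewrite /gen_mx inord_val.
case: b => //.
have -> : to_presented (@braid_rel q.+2) [:: (i, true)] = ((braid_gen i)^-1)%g.
  by rewrite -to_presented_inv.
rewrite rep_mxV trmx_inv; set A := trmx _ in Wi *.
have Au : A \in unitmx by rewrite unitmx_tr rep_mx_unit.
(* By rank, an inclusion [W *m A <= W] with [A] invertible is an equality, so inverse letters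
   preserve [W] too. *)
have WA : (W <= W *m A)%MS.
  by rewrite -(mxrank_leqif_sup Wi) mxrankMfree ?row_free_unit.
by apply: submx_trans (submxMr _ WA) _; rewrite mulmxK.
Qed.

Lemma irreducible_rep_rows : irreducible_rep phi ->
  forall W : 'M[C]_m, (forall i, (i < q.+1)%N -> (W *m gen_mx i <= W)%MS) ->
  W = 0 \/ row_full W.
Proof.
case=> _ irr W /stable_rep Wphi.
(* The kernel of [f] consists of the columns whose transposes lie in the row space of [W]. *)
pose f : 'Hom('cV[C]_m, 'rV[C]_m) := linfun (mulmxr (cokermx W) \o trmx).
have memV v : (v \in lker f) = (v^T <= W)%MS.
  by rewrite memv_ker lfunE /= submxE.
case: (irr (lker f)) => [g v|V0|Vfull].
- by rewrite !memV trmx_mul => vW; apply: submx_trans (submxMr _ vW) (Wphi g).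
- left; apply/row_matrixP => i; rewrite row0; apply: trmx_inj; rewrite trmx0.
  by apply/eqP; rewrite -memv0 -V0 memV trmxK row_sub.
right; rewrite -sub1mx; apply/row_subP => i.
by rewrite -[row _ _]trmxK -memV Vfull memvf.
Qed.

End Representation.

(** * From dimensions to levels *)

Theorem theorem3p3 (R : realType) :
  forall l : nat, (1 <= l)%N ->
  exists N : nat, forall n : nat, (N <= n)%N ->
  forall (m : nat)
         (phi : {multiplicative braid_group n -> unitary_group R[i] m}),
    irreducible_rep phi -> (m <= l * n)%N ->
    exists! k : nat, (k <= l)%N /\ of_level phi k.
Proof.
(* The part [8 * l + 16] gives [4 * l + 8 <= p], hence [l * n < 'C(p, 2)]; adding [l * l] makes the
   levels up to [l] disjoint. *)
move=> l l1; exists (l * l + 8 * l + 16)%N => -[|[|q]] nN m phi irr ml;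
  [by lia | by lia |].
have m0 : (0 < m)%N by case: irr.
set p := (q.+2)./2.
have pq : (p.*2 <= q.+2)%N by rewrite /p; lia.
have p_big : (4 * l + 8 <= p)%N by rewrite /p; lia.
have qp : (q.+2 <= 2 * p + 1)%N by rewrite /p; lia.
have mC : (0 < m < 'C(p, 2))%N.
  rewrite m0 bin2 /=; have : (l * q.+2 <= l * (2 * p + 1))%N by rewrite leq_mul.
  by have : (p * (4 * l + 7) <= p * p.-1)%N by [rewrite leq_mul //; lia]; nia.
have p7 : (7 <= p)%N by lia.
have := irreducible_family_dim (gen_mx_braid_family phi)
  (fun i _ => diagonalizable_unitarymx (gen_mx_unitary phi i))
  (irreducible_rep_rows irr) pq p7 mC.
have level_unique k k' : (k <= l)%N -> (k' <= l)%N ->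
    of_level phi k -> of_level phi k' -> ~ (k < k')%N.
  move=> kl k'l [_ kP] [_ [[-> _]|[k'1 /andP[lo _]]]] kk'; first by lia.
  (* The [+ 1] covers level 0, where [m = 1]. *)
  have mk : (m <= k * q.+2 + 1)%N by case: kP => [[-> ->]|[_ /andP[_]]]; nia.
  have : (k' * k' <= l * l)%N by rewrite leq_mul.
  have : ((k' - k) * q.+2 >= q.+2)%N by rewrite leq_pmull; lia.
  by nia.
move=> dims; suff [k [kl kP]] : exists k, (k <= l)%N /\ of_level phi k.
  exists k; split=> // k' [k'l k'P].
  have [kk'|kk'|//] := ltngtP k k'; by case: (level_unique _ _ _ _ _ _ kk').
case: dims => [m1|[k [d [k1 dk lo hi]]]].
  by exists 0%N; split=> //; split=> //; left.
(* Otherwise [l.+1 * q <= m <= l * q.+2], so [q <= 2 * l], which is too small. *)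
have kl : (k <= l)%N.
  rewrite leqNgt; apply/negP => lk.
  have : (l.+1 * q <= k * q)%N by rewrite leq_mul.
  by move: lo ml => /=; nia.
exists k; split=> //; split=> //; right; split=> //.
(* Below, [m] is at least [k * q], that is k n - 2 k, and 2 k <= k^2 + 3 k - 2 as k >= 1. Above,
   [d <= k] gives m <= k n. *)
by move: lo hi => /= lo hi; apply/andP; split; nia.
Qed.
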